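(* Let $G$ be a network, let $G'$ be a (nonfanout) inflation of $G$, and let $\{\rho_{\bm{U}}:\bm{U}\in\mathsf{ImagesInjectableSets}(G)\}$ be a family of states that is compatible with $G$. Let $T'\subseteq\mathsf{ExpressibleSets}(G')$. If $I_{T'}$ is a causal compatibility inequality for $G'$ operating on families of states $\{\tau_{\bm{Y}'}:\bm{Y}'\in T'\}$, then the family of states $\{\sigma_{\bm{Y}'}:\bm{Y}'\in T'\}$ defined by $$\sigma_{\bm{Y}'}:=\bigotimes_{j=1}^{y}\rho_{\bm{U}_{(j)}},$$ with $\bm{U}'_{(1)},\dots,\bm{U}'_{(y)}$ the injectable components of $\bm{Y}'$, $\bm{U}_{(j)}$ the image of $\bm{U}'_{(j)}$, and the $j$-th factor regarded as a state on the systems $\bm{U}'_{(j)}$, satisfies $I_{T'}$.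
   Context: All Hilbert spaces are finite-dimensional. A network $G$ is a directed acyclic graph whose nodes are partitioned into visible nodes $\mathsf{Vnodes}(G)$ and latent nodes $\mathsf{Lnodes}(G)$, with all edges going from latent to visible nodes. $\mathrm{Pa}$ and $\mathrm{Ch}$ denote parents and children. Compatibility of a state. Each visible node $A$ carries a given Hilbert space $\mathcal{H}_A$. A state $\rho$ on $\bigotimes_{A\in\mathsf{Vnodes}(G)}\mathcal{H}_A$ is $G$-compatible if for each latent node $L$ there are finite-dimensional spaces $\mathcal{H}_{L^{(A)}}$, $A\in\mathrm{Ch}(L)$, and a state $\rho_L$ on $\bigotimes_{A\in\mathrm{Ch}(L)}\mathcal{H}_{L^{(A)}}$, and for each visible node $A$ a quantum channel (completely positive trace-preserving map) $\mathcal{E}_A$ from operators on $\bigotimes_{L\in\mathrm{Pa}(A)}\mathcal{H}_{L^{(A)}}$ to operators on $\mathcal{H}_A$, such that $\rho=\big(\bigotimes_{A}\mathcal{E}_A\big)\big(\bigotimes_{L}\rho_L\big)$. A family of states $\{\rho_{\bm{X}}\}$ indexed by subsets $\bm{X}$ of visible nodes is compatible with $G$ if there is a $G$-compatible state on all the visible nodes whose reduced state on $\bm{X}$ is $\rho_{\bm{X}}$ for every $\bm{X}$ in the index family. Causal compatibility inequality. For a network $G'$ and a family $T'$ of subsets of its visible nodes, an inequality $I_{T'}$ (a condition on families of states $\{\tau_{\bm{Y}'}:\bm{Y}'\in T'\}$) is a causal compatibility inequality for $G'$ if it is satisfied by every family $\{\tau_{\bm{Y}'}:\bm{Y}'\in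 T'\}$ that is compatible with $G'$. Inflation. Consider a directed acyclic graph $G'$ with visible and latent nodes, together with a surjective map (''dropping copy indices'') from nodes of $G'$ to nodes of $G$ taking visible nodes to visible nodes and latent nodes to latent nodes; nodes of $G'$ mapped to $A$ are called copies of $A$ and written $A_i$. The ancestral subgraph of a set of nodes is the induced subgraph on that set together with all ancestors of its elements. For sets of nodes $\bm{U}'$ of $G'$ and $\bm{U}$ of $G$, write $\mathsf{ansubgraph}_{G'}(\bm{U}')\sim\mathsf{ansubgraph}_G(\bm{U})$ if dropping copy indices restricts to a bijection $\bm{U}'\to\bm{U}$ and to a graph isomorphism from the ancestral subgraph of $\bm{U}'$ in $G'$ to that of $\bm{U}$ in $G$. $G'$ is an inflation of $G$ if $\mathsf{ansubgraph}_{G'}(\{A_i\})\sim\mathsf{ansubgraph}_G(\{A\})$ for every node $A_i$ of $G'$ (so $G'$ is itself a network). It is nonfanout if no latent node of $G'$ has two distinct children that are copies of the same visible node of $G$. Each visible node $A_i$ of $G'$ carries a copy of the Hilbert space $\mathcal{H}_A$. A set $\bm{U}'\subseteq\mathsf{Vnodes}(G')$ is injectable if there is $\bm{U}\subseteq\mathsf{Vnodes}(G)$ with $\mathsf{ansubgraph}_{G'}(\bm{U}')\sim\mathsf{ansubgraph}_G(\bm{U})$; $\bm{U}$ is then the image of $\bm{U}'$. $\mathsf{ImagesInjectableSets}(G)$ is the set of all images of injectable sets of $G'$. A set $\bm{Y}'\subseteq\mathsf{Vnodes}(G')$ is expressible, $\bm{Y}'\in\mathsf{ExpressibleSets}(G')$,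 if $\bm{Y}'=\bigcup_{j=1}^y\bm{U}'_{(j)}$ with each $\bm{U}'_{(j)}$ injectable and the ancestral subgraphs of the $\bm{U}'_{(j)}$ in $G'$ pairwise disjoint; for each expressible $\bm{Y}'$ fix such a decomposition and call the $\bm{U}'_{(j)}$ its injectable components. *)

(* Defs.v *)
From HB Require Import structures.
From mathcomp Require Import all_boot all_order all_algebra.
From mathcomp Require Import reals complex.

Set Implicit Arguments.
Unset Strict Implicit.
Unset Printing Implicit Defensive.

Import Order.TTheory GRing.Theory Num.Theory.
Local Open Scope ring_scope.
Local Open Scope sesquilinear_scope.

(** * Operators on finite-dimensional Hilbert spaces *)

(* A finite-dimensional Hilbert space is given by a finite type I indexing an
   orthonormal basis; operators on it are the matrices in that basis. *)
Notation op C I := 'M[C]_#|{: I}|.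

(* Basis of the tensor product of the spaces with bases I k, k : K. *)
Definition tens (K : finType) (I : K -> finType) : finType :=
  {dffun forall k : K, I k}.

(* Basis of the tensor product of the factors in S only. *)
Definition stens (K : finType) (I : K -> finType) (S : {set K}) : finType :=
  tens (fun k : {k : K | k \in S} => I (val k)).

Section Operators.
Variable C : numClosedFieldType.

Definition ent (I : finType) (X : op C I) (x y : I) : C :=
  X (enum_rank x) (enum_rank y).

Definition mkop (I : finType) (f : I -> I -> C) : op C I :=
  \matrix_(i, j) f (enum_val i) (enum_val j).

(* The matrix unit |x><y|. *)
Definition ketbra (I : finType) (x y : I) : op C I :=
  delta_mx (enum_rank x) (enum_rank y).

(* Over C this implies that X is Hermitian. *)
Definition psd (n : nat) (X : 'M[C]_n) : Prop :=
  forall v : 'cV[C]_n, 0 <= (v ^t* *m X *m v) 0 0.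

Definition is_state (I : finType) (X : op C I) : Prop := psd X /\ \tr X = 1.

(* id_n (x) E, acting blockwise on operators on C^n (x) H. *)
Definition ampliation (I J : finType) (n : nat) (E : op C I -> op C J)
    (X : op C ('I_n * I)%type) : op C ('I_n * J)%type :=
  mkop (fun x y : 'I_n * J =>
    ent (E (mkop (fun i j : I => ent X (x.1, i) (y.1, j)))) x.2 y.2).

Definition completely_positive (I J : finType) (E : op C I -> op C J) : Prop :=
  forall (n : nat) (X : op C ('I_n * I)%type), psd X -> psd (ampliation E X).

Definition trace_preserving (I J : finType) (E : op C I -> op C J) : Prop :=
  forall X : op C I, \tr (E X) = \tr X.

Definition is_channel (I J : finType) (E : op C I -> op C J) : Prop :=
  [/\ linear E, completely_positive E & trace_preserving E].

Definition tens_op (K : finType) (I : K -> finType) (X : forall k, op C (I k)) :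
    op C (tens I) :=
  mkop (fun p q : tens I => \prod_k ent (X k) (p k) (q k)).

(* Tensor product of linear maps: the linear extension of
   (x)_k |p k><q k|  |->  (x)_k E k (|p k><q k|). *)
Definition tens_map (K : finType) (I J : K -> finType)
    (E : forall k, op C (I k) -> op C (J k)) (X : op C (tens I)) :
    op C (tens J) :=
  \sum_(p : tens I) \sum_(q : tens I)
    ent X p q *: tens_op (fun k => E k (ketbra (p k) (q k))).

Definition restr (K : finType) (I : K -> finType) (S : {set K}) (p : tens I) :
    stens I S :=
  [ffun k : {k : K | k \in S} => p (val k)].

(* Partial trace over the factors outside S: the (x, y) entry sums the entries
   of X at the pairs (p, q) that extend (x, y) and coincide outside S. *)
Definition reduced (K : finType) (I : K -> finType) (S : {set K})
    (X : op C (tens I)) : op C (stens I S) :=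
  mkop (fun x y : stens I S =>
    \sum_(p : tens I | restr S p == x)
      \sum_(q : tens I | (restr S q == y) &&
                         [forall k, (k \notin S) ==> (p k == q k)]) ent X p q).

(* For a bijection g between bases, pull g and push g both conjugate by the
   induced unitary, which goes from J to I for pull, from I to J for push. *)
Definition pull (I J : finType) (g : J -> I) (X : op C I) : op C J :=
  mkop (fun p q : J => ent X (g p) (g q)).

Definition push (I J : finType) (g : I -> J) (X : op C I) : op C J :=
  mkop (fun p q : J => \sum_(u | g u == p) \sum_(v | g v == q) ent X u v).

End Operators.

(** * Directed acyclic graphs with visible and latent nodes *)

Record dag := Dag {
  vnode : finType;
  lnode : finType;
  edge : rel (vnode + lnode)%type;
  edge_acyclic : forall x y, edge x y -> ~~ connect edge y x }.

Definition node (G : dag) : finType := (vnode G + lnode G)%type.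

Definition is_network (G : dag) : Prop :=
  forall x y : node G, edge x y -> exists L A, x = inr L /\ y = inl A.

(* Children of a latent node and parents of a visible node; when G is a
   network these are all the edges of G. *)
Definition children (G : dag) (L : lnode G) : finType :=
  {A : vnode G | edge (inr L) (inl A)}.

Definition parents (G : dag) (A : vnode G) : finType :=
  {L : lnode G | edge (inr L) (inl A)}.

Definition vset (G : dag) (U : {set vnode G}) : {set node G} :=
  [set inl A | A in U].

(* Each node is its own ancestor here, since connect is reflexive. *)
Definition ancestral (G : dag) (U : {set node G}) : {set node G} :=
  [set x | [exists u in U, connect (@edge G) x u]].

(** * Compatibility with a network *)

Section Compatibility.
Variables (C : numClosedFieldType) (G : dag) (d : vnode G -> nat).

Section Regroup.
Variable dL : lnode G -> vnode G -> nat.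

(* The system L^(A), for an edge L -> A, has dimension dL L A. *)
Definition lout (L : lnode G) : finType :=
  tens (fun A : children L => 'I_(dL L (val A))).

Definition vin (A : vnode G) : finType :=
  tens (fun L : parents A => 'I_(dL (val L) A)).

(* Identifies (x)_A (x)_{L in Pa(A)} L^(A) with (x)_L (x)_{A in Ch(L)} L^(A). *)
Definition regroup (p : tens vin) : tens lout :=
  [ffun L : lnode G =>
    [ffun A : children L => p (val A) (exist _ L (valP A))] : lout L].
End Regroup.

(* The visible node A carries C^(d A). *)
Definition vis (A : vnode G) : finType := 'I_(d A).

Definition state_compatible (rho : op C (tens vis)) : Prop :=
  is_state rho /\
  exists (dL : lnode G -> vnode G -> nat)
         (rhoL : forall L, op C (lout dL L))
         (E : forall A, op C (vin dL A) -> op C (vis A)),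
    [/\ forall L, is_state (rhoL L),
        forall A, is_channel (E A)
      & rho = tens_map E (pull (@regroup dL) (tens_op rhoL))].

(* Families indexed by a family T of sets of visible nodes, of operators rather
   than of states: a condition on families of states is a predicate on these
   which may be false, or arbitrary, when some member is not a state. *)
Definition op_family (T : {set {set vnode G}}) : Type :=
  forall X : {X : {set vnode G} | X \in T}, op C (stens vis (val X)).

(* The members of a compatible family are states, being reductions of one. *)
Definition compatible (T : {set {set vnode G}}) (rho : op_family T) : Prop :=
  exists2 r : op C (tens vis), state_compatible r &
    forall X, reduced (val X) r = rho X.

Definition causal_compatibility_ineq (T : {set {set vnode G}})
    (P : op_family T -> Prop) : Prop :=
  forall tau : op_family T, compatible tau -> P tau.

End Compatibility.

(** * Inflations *)

(* The surjection "dropping copy indices". *)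
Record copymap (G' G : dag) := CopyMap {
  dropV : vnode G' -> vnode G;
  dropL : lnode G' -> lnode G;
  dropV_surj : forall A, exists A', dropV A' = A;
  dropL_surj : forall L, exists L', dropL L' = L }.

Section Inflation.
Variables (G' G : dag) (pi : copymap G' G).

Definition dropnode (x : node G') : node G :=
  match x with inl A => inl (dropV pi A) | inr L => inr (dropL pi L) end.

Definition ansim (U' : {set node G'}) (U : {set node G}) : bool :=
  [&& dinjectiveb dropnode (mem U'), dropnode @: U' == U,
      dinjectiveb dropnode (mem (ancestral U')),
      dropnode @: ancestral U' == ancestral U
    & [forall x in ancestral U', forall y in ancestral U',
        edge x y == edge (dropnode x) (dropnode y)]].

Definition inflation : Prop := forall x : node G', ansim [set x] [set dropnode x].

(* Hence compatibility with an inflation G' is compatibility with a network. *)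
Lemma inflation_network : is_network G -> inflation -> is_network G'.
Proof.
move=> netG infl x y exy.
have ay : y \in ancestral [set y].
  by rewrite inE; apply/existsP; exists y; rewrite set11 connect0.
have ax : x \in ancestral [set y].
  by rewrite inE; apply/existsP; exists y; rewrite set11 connect1.
have /and5P[_ _ _ _ /forall_inP/(_ x ax)/forall_inP/(_ y ay)/eqP] := infl y.
rewrite exy => /esym/netG[L [A []]].
by case: x y {ax ay exy} => [A1|L1] [A2|L2] // _ _; exists L1, A2.
Qed.

Definition nonfanout : Prop :=
  forall (L : lnode G') (A B : vnode G'),
    edge (inr L) (inl A) -> edge (inr L) (inl B) ->
    dropV pi A = dropV pi B -> A = B.

Definition injectable (U' : {set vnode G'}) : bool :=
  [exists U : {set vnode G}, ansim (vset U') (vset U)].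

Definition ImagesInjectableSets : {set {set vnode G}} :=
  [set U | [exists U' : {set vnode G'}, ansim (vset U') (vset U)]].

Lemma ansim_image (U' : {set vnode G'}) (U : {set vnode G}) :
  ansim (vset U') (vset U) -> U = dropV pi @: U'.
Proof.
case/and5P=> _ /eqP eqU _ _ _; apply: (imset_inj (@inl_inj _ (lnode G))).
by rewrite -[LHS]eqU /vset -!imset_comp; apply: eq_imset.
Qed.

Lemma injectable_image (U' : {set vnode G'}) :
  injectable U' -> dropV pi @: U' \in ImagesInjectableSets.
Proof.
case/existsP=> U sU; rewrite inE; apply/existsP; exists U'.
by rewrite -(ansim_image sU).
Qed.

Record decomposition (Y : {set vnode G'}) := Decomposition {
  ncomp : nat;
  component : 'I_ncomp -> {set vnode G'};
  comp_cover : Y = \bigcup_j component j;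
  comp_injectable : forall j, injectable (component j);
  comp_disjoint : forall i j, i != j ->
    [disjoint ancestral (vset (component i)) & ancestral (vset (component j))] }.

Definition expressible (Y : {set vnode G'}) : Prop :=
  inhabited (decomposition Y).

Lemma comp_sub (Y : {set vnode G'}) (D : decomposition Y) (j : 'I_(ncomp D))
    (A : {A : vnode G' | A \in component j}) : val A \in Y.
Proof.
suff: val A \in \bigcup_(i < ncomp D) component i by rewrite -comp_cover.
by apply/bigcupP; exists j => //; exact: valP A.
Qed.

Section Product.
Variables (C : numClosedFieldType) (d : vnode G -> nat).

(* Each copy of A carries a copy of the space of A. *)
Definition copydim (A : vnode G') : nat := d (dropV pi A).

(* Identifies the systems U with the systems U', U being the image of U'. *)
Definition copy_basis (U' : {set vnode G'}) (u : stens (vis d) (dropV pi @: U')) :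
    stens (vis copydim) U' :=
  [ffun A : {A : vnode G' | A \in U'} =>
    (u (exist _ (dropV pi (val A)) (imset_f (dropV pi) (valP A)))
      : vis copydim (val A))].

Variables (Y : {set vnode G'}) (D : decomposition Y).

(* Identifies the systems Y with the disjoint union of the components. *)
Definition split_basis (p : stens (vis copydim) Y) :
    tens (fun j : 'I_(ncomp D) => stens (vis copydim) (component j)) :=
  [ffun j : 'I_(ncomp D) =>
    [ffun A : {A : vnode G' | A \in component j} =>
      (p (exist _ (val A) (comp_sub A)) : vis copydim (val A))]
      : stens (vis copydim) (component j)].

Definition product_state (rho : op_family C d ImagesInjectableSets) :
    op C (stens (vis copydim) Y) :=
  pull split_basis (tens_op (fun j : 'I_(ncomp D) =>
    push (@copy_basis (component j))
      (rho (exist _ (dropV pi @: component j)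
                    (injectable_image (comp_injectable j)))))).
End Product.

End Inflation.

(* Main.v *)
(* A realization of a compatible state on G is copied onto G': each copy of a
   visible node A applies the channel of A, and each copy of a latent node L
   emits the state of L, reduced to the systems that its children in G' are
   copies of.  Write an entry of a marginal of the resulting state as a sum, over
   pairs of basis labels of all systems emitted by latent nodes, of a product of
   latent and visible factors.  A latent node without a child in the marginal
   contributes the factor 1, being a trace; so for an injectable set the sum only
   runs over the latent ancestors, and dropping copy indices turns it into the
   sum for the image in G.  For an expressible set the components have disjoint
   ancestral subgraphs and the sum factorizes.  Hence the marginals of the
   inflated state are the product states, which therefore form a family that is
   compatible with G'.  *)

Require Import Defs.
From HB Require Import structures.
From mathcomp Require Import all_boot all_order all_algebra.
From mathcomp Require Import reals complex ring.

Set Implicit Arguments.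
Unset Strict Implicit.
Unset Printing Implicit Defensive.

Import Order.TTheory GRing.Theory Num.Theory.
Local Open Scope ring_scope.
Local Open Scope sesquilinear_scope.

(** * Sums over dependent products *)

Section DependentProducts.

(** Distributivity where the index type varies with [k]: each inner sum is moved to the tagged union
    of the types [I k], where the non-dependent law applies. *)
Lemma sum_tens_prod (R : comPzSemiRingType) (K : finType) (I : K -> finType)
    (F : forall k, I k -> R) :
  \sum_(p : tens I) \prod_k F k (p k) = \prod_k \sum_x F k x.
Proof.
pose F' k := [ffun x => F k x].
transitivity (\prod_k \sum_x F' k x); last first.
  by apply: eq_bigr => k _; apply: eq_bigr => x _; rewrite ffunE.
under [RHS]eq_bigr => k _ do rewrite (big_tag (fun k => F' k : _ -> R)).
rewrite bigA_distr_big_dep -big_fprod (reindex (@dffun_of_fprod _ I)) /=; last first.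
  exact/onW_bij/dffun_of_fprod_bij.
by apply: eq_bigr => p _; apply: eq_bigr => k _; rewrite !ffunE.
Qed.

Lemma sum_tens_prod2 (R : comPzSemiRingType) (K : finType) (I J : K -> finType)
    (F : forall k, I k -> J k -> R) :
  \sum_(p : tens I) \sum_(q : tens J) \prod_k F k (p k) (q k) =
  \prod_k \sum_x \sum_y F k x y.
Proof.
rewrite -sum_tens_prod; apply: eq_bigr => p _.
by rewrite (sum_tens_prod (fun k => F k (p k))).
Qed.

Lemma prod_natb (R : comPzSemiRingType) (K : finType) (P b : pred K) :
  \prod_(k | P k) (b k)%:R = [forall (k | P k), b k]%:R :> R.
Proof.
case: forall_inP => [h | /forall_inP]; first by rewrite big1 // => k /h ->.
rewrite negb_forall => /existsP[k]; rewrite negb_imply => /andP[Pk /negbTE bk].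
by rewrite (bigD1 k) //= bk mul0r.
Qed.

Variables (K : finType) (I : K -> finType).

(** A coordinate in the range of [f] has a unique preimage, so its value can be read off [q]; the
    other coordinates default to those of [p0]. *)
Lemma tens_along (K' : finType) (f : K' -> K) (p0 : tens I)
    (q : tens (fun k => I (f k))) : injective f ->
  {p : tens I | forall k, p (f k) = q k}.
Proof.
move=> finj.
have [g gP] : {g : forall k, I k | forall k', g (f k') = q k'}.
  (* The value at [k] is specified through transports along the equalities [f k' = k], because
     [q k'] lives in [I (f k')] and not in [I k]. *)
  suff g k : {x : I k | forall k' (e : f k' = k), x = ecast k (I k) e (q k')}.
    by exists (fun k => sval (g k)) => k'; case: (g (f k')) => x /= /(_ k' erefl).
  case: (pickP (fun k' => f k' == k)) => [k' /eqP ek | none].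
    case: k / ek; exists (q k') => k2 e; have e2 := finj _ _ e.
    by case: k' / e2 e => e; rewrite eq_axiomK.
  by exists (p0 k) => k' e; case/eqP: (none k').
by exists [ffun k => g k] => k; rewrite ffunE gP.
Qed.

(** Matching on the reflection view supplies the membership proof that indexes [z]. *)
Definition extend (S : {set K}) (p0 : tens I) (z : stens I S) : tens I :=
  [ffun k => match @idP (k \in S) with
             | ReflectT h => z (exist _ k h)
             | ReflectF _ => p0 k end].

Lemma extendE (S : {set K}) p0 (z : stens I S) k (h : k \in S) : extend p0 z k = z (exist _ k h).
Proof.
rewrite ffunE; case: {-}_ / idP => [h' | /(_ h)//].
by rewrite (bool_irrelevance h h').
Qed.

Lemma restr_extend (S : {set K}) p0 (z : stens I S) : restr S (extend p0 z) = z.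
Proof. by apply/ffunP => -[k h]; rewrite ffunE /= extendE. Qed.

Lemma restr_eq (S : {set K}) (p q : tens I) :
  (restr S p == restr S q) = [forall (k | k \in S), p k == q k].
Proof.
apply/eqP/forall_inP => [e k kS | e].
  by have /ffunP/(_ (exist _ k kS)) := e; rewrite !ffunE => ->.
by apply/ffunP => -[k kS]; rewrite !ffunE; apply/eqP/e.
Qed.

(** Cutting a label along the fibres of the colouring [c] is a bijection onto a product, with
    inverse [glue]. Since factor [j] only sees coordinates of colour [j], the sum distributes. *)
Lemma sum_tens_classes (R : comPzSemiRingType) (J : finType) (c : K -> J)
    (F : J -> tens I -> R) (p0 : tens I) :
  (forall j (p q : tens I), (forall k, c k = j -> p k = q k) -> F j p = F j q) ->
  \sum_(p : tens I) \prod_j F j p =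
  \prod_j \sum_(z : stens I [set k | c k == j]) F j (extend p0 z).
Proof.
move=> Floc; pose S j := [set k | c k == j].
have cS k : k \in S (c k) by rewrite inE.
pose glue (z : tens (fun j => stens I (S j))) : tens I :=
  [ffun k => z (c k) (exist _ k (cS k))].
pose cut (p : tens I) : tens (fun j => stens I (S j)) := [ffun j => restr (S j) p].
have cutK : cancel cut glue by move=> p; apply/ffunP=> k; rewrite !ffunE.
have glueK : cancel glue cut.
  move=> z; apply/ffunP=> j; apply/ffunP=> -[k kS]; rewrite !ffunE /=.
  have e : c k = j by apply/eqP; rewrite inE in kS.
  by case: j / e kS => kS; rewrite (bool_irrelevance (cS k) kS).
rewrite -(sum_tens_prod (fun j z => F j (extend p0 z))) (reindex glue) /=; last first.
  by apply: onW_bij; exists cut.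
apply: eq_bigr => z _; apply: eq_bigr => j _; apply: Floc => k ck.
by case: j / ck; rewrite (extendE _ _ (cS k)) ffunE.
Qed.

End DependentProducts.

(** [f] identifies the coordinates in [S'] with those in [f @: S'], so the labels on both sets
    correspond. This is how copy indices are dropped in a sum. *)
Lemma sum_extend_along (R : nmodType) (K K' : finType) (I : K -> finType)
    (f : K' -> K) (S' : {set K'})
    (p0 : tens I) (p0' : tens (fun k => I (f k)))
    (F : tens I -> R) (F' : tens (fun k => I (f k)) -> R) :
  {in S' &, injective f} ->
  (forall (p' : tens (fun k => I (f k))) (p : tens I),
    {in S', forall k, p' k = p (f k)} -> F' p' = F p) ->
  \sum_(z : stens (fun k => I (f k)) S') F' (extend p0' z) =
  \sum_(z : stens I (f @: S')) F (extend p0 z).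
Proof.
move=> finj FF'.
pose g (z : stens I (f @: S')) : stens (fun k => I (f k)) S' :=
  [ffun k : {k | k \in S'} => z (exist _ (f (val k)) (imset_f f (valP k)))].
have finj' : injective (fun k : {k | k \in S'} => f (val k)).
  by move=> k l /finj e; apply/val_inj/e; apply: valP.
pose g' z := restr (f @: S') (sval (tens_along p0 z finj')).
have g'K : cancel g' g.
  by move=> z; apply/ffunP=> k; rewrite !ffunE /= (svalP (tens_along p0 z finj') k).
have g_inj : injective g.
  move=> z1 z2 /ffunP e; apply/ffunP => -[k kS].
  case/imsetP: (kS) => k' kS' ek; case: k / {ek}(esym ek) kS => kS.
  by have := e (exist _ k' kS'); rewrite !ffunE /= (bool_irrelevance (imset_f f _) kS).
have g_bij : bijective g by exists g' => // z; apply: g_inj; rewrite g'K.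
rewrite (reindex g) /=; last by apply: onW_bij.
apply: eq_bigr => z _; apply: FF' => k kS.
by rewrite (extendE _ _ kS) ffunE /= -(extendE p0).
Qed.

(** Integration against a weight pushed forward along [g]: with the fibre conditions written as
    indicators, each [p] meets exactly one [q], its image. *)
Lemma sum_tens_fibers (R : comPzSemiRingType) (K : finType) (I J : K -> finType)
    (g : forall k, I k -> J k) (h : forall k, I k -> R) (F : tens J -> R) :
  \sum_(q : tens J) (\prod_k \sum_(x | g k x == q k) h k x) * F q =
  \sum_(p : tens I) (\prod_k h k (p k)) * F [ffun k => g k (p k)].
Proof.
transitivity (\sum_(q : tens J) \sum_(p : tens I)
    (\prod_k (g k (p k) == q k)%:R) * (\prod_k h k (p k)) * F q).
  apply: eq_bigr => q _; rewrite -mulr_suml; congr (_ * _).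
  under [RHS]eq_bigr => p _ do rewrite -big_split /=.
  rewrite (sum_tens_prod (fun k x => (g k x == q k)%:R * h k x)).
  apply: eq_bigr => k _; rewrite big_mkcond; apply: eq_bigr => x _.
  by case: eqP => _; rewrite ?mul1r ?mul0r.
rewrite exchange_big /=; apply: eq_bigr => p _.
pose q0 : tens J := [ffun k => g k (p k)].
rewrite (bigD1 q0) //= [Y in _ + Y]big1 => [|q nq].
  by rewrite addr0 big1 ?mul1r // => k _; rewrite ffunE eqxx.
rewrite (prod_natb _ predT); case: forallP => [e|_]; last by rewrite !mul0r.
by case/eqP: nq; apply/ffunP => k; rewrite ffunE; apply/esym/eqP/e.
Qed.

Lemma sum_tens_pairs (R : nmodType) (K : finType) (I J : K -> finType)
    (F : tens I -> tens J -> R) :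
  \sum_(p : tens I) \sum_(q : tens J) F p q =
  \sum_(z : tens (fun k => (I k * J k)%type : finType))
    F [ffun k => (z k).1] [ffun k => (z k).2].
Proof.
rewrite pair_big /=.
rewrite (reindex (fun z : tens (fun k => (I k * J k)%type : finType) =>
  ([ffun k => (z k).1] : tens I, [ffun k => (z k).2] : tens J))) //=.
exists (fun w : tens I * tens J => [ffun k => (w.1 k, w.2 k)]) => [z _ | [p q] _] /=.
  by apply/ffunP => k; rewrite !ffunE -surjective_pairing.
by congr (_, _); apply/ffunP => k; rewrite !ffunE.
Qed.

Lemma sum_stens_prod (R : comPzSemiRingType) (K : finType) (I : K -> finType)
    (S : {set K}) (p0 : tens I) (h : forall k, I k -> R) :
  \sum_(z : stens I S) \prod_(k in S) h k (extend p0 z k) =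
  \prod_(k in S) \sum_x h k x.
Proof.
transitivity (\sum_(z : stens I S) \prod_(k : {k | k \in S}) h (val k) (z k)).
  apply: eq_bigr => z _; etransitivity; first exact: big_sub.
  by apply: eq_bigr => -[k kS] _ /=; rewrite extendE.
etransitivity; first exact: (sum_tens_prod (fun k : {k | k \in S} => @h (val k))).
by symmetry; exact: big_sub.
Qed.

Section Operators.
Variable C : numClosedFieldType.

(** * Positivity, channels and partial traces *)

Lemma conj_delta n i : (delta_mx i 0 : 'cV[C]_n) ^t* = delta_mx 0 i.
Proof.
by apply/matrixP=> a b; rewrite !mxE andbC; case: (_ && _); rewrite ?conjC0 ?conjC1.
Qed.

(** Polarization: the form is real on the diagonal, at e_i + e_j and at e_i + i e_j, and these
    relations determine [A j i] from [A i j]. *)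
Lemma psd_herm n (A : 'M[C]_n) i j : psd A -> A j i = (A i j)^*.
Proof.
move=> Apsd; pose f (u v : 'cV[C]_n) := (u ^t* *m A *m v) 0 0.
have tD (u v : 'cV[C]_n) c : (u + c *: v) ^t* = u ^t* + c^* *: v ^t*.
  by apply/matrixP=> k l; rewrite !mxE rmorphD rmorphM.
have fE k l : f (delta_mx k 0) (delta_mx l 0) = A k l.
  by rewrite /f conj_delta -mulmxA -colE -rowE !mxE.
have fD c : f (delta_mx i 0 + c *: delta_mx j 0) (delta_mx i 0 + c *: delta_mx j 0)
   = A i i + c * A i j + c^* * A j i + c * c^* * A j j.
  rewrite -!fE /f tD !mulmxDl !mulmxDr -!scalemxAl -!scalemxAr scalerA.
  have aD (M N : 'M[C]_1) : (M + N) 0 0 = M 0 0 + N 0 0 by rewrite mxE.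
  have aZ x (M : 'M[C]_1) : (x *: M) 0 0 = x * M 0 0 by rewrite mxE.
  by rewrite !(aD, aZ); ring.
have r v : (f v v)^* = f v v by apply/CrealP; rewrite ger0_real //; apply: Apsd.
have d k : (A k k)^* = A k k by rewrite -fE r.
have := r (delta_mx i 0 + 1 *: delta_mx j 0).
have := r (delta_mx i 0 + 'i *: delta_mx j 0).
rewrite !fD !(rmorphD, rmorphM) /= !conjCK !d rmorph1 conjCi !(mul1r, mulr1).
move=> e2 e1.
have e3 : 2 * 'i != 0 :> C by rewrite mulf_neq0 ?neq0Ci // pnatr_eq0.
apply: (mulfI e3).
move/eqP: e2; rewrite -subr_eq0 => /eqP e2; move/eqP: e1; rewrite -subr_eq0 => /eqP e1.
(* The difference of the two sides, times 2i, is the relation at i minus i times the relation at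
   1. *)
apply/eqP; rewrite -subr_eq0 -[X in _ == X](subr0 0) -{1}e2 -(mulr0 'i) -e1; apply/eqP; ring.
Qed.

(** Diagonalize [A] by the unitary [U]; the eigenvalues are nonnegative, so the diagonal of their
    square roots times [U] is a Gram factor. *)
Lemma psd_factor n (A : 'M[C]_n) : psd A -> {B : 'M[C]_n | A = B ^t* *m B}.
Proof.
move=> Apsd; apply: sig_eqW.
have Aherm : A \is hermsymmx.
  apply/is_hermitianmxP; rewrite expr0 scale1r; apply/matrixP=> i j.
  by rewrite !mxE -psd_herm.
have /hermitian_normalmx/orthomx_spectralP := Aherm.
set U := spectralmx A; set s := spectral_diag A => defA.
have Uu : U \is unitarymx := spectral_unitarymx A.
have s_ge0 i : 0 <= s 0 i.
  (* The form is tested at the i-th eigenvector. *)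
  have := Apsd (U ^t* *m delta_mx i 0).
  rewrite defA invmx_unitary // trmx_mul map_mxM trmxCK !mulmxA.
  rewrite !mulmxtVK // conj_delta -mulmxA -colE -rowE !mxE eqxx mulr1n.
  done.
pose D := diag_mx (map_mx sqrtC s).
exists (D *m U).
have cD : D ^t* = D.
  apply/matrixP=> i j; rewrite !mxE eq_sym; case: eqP => [->|_]; rewrite ?mulr0n ?conjC0 //.
  by rewrite !mulr1n conj_Creal // ger0_real // sqrtC_ge0.
rewrite trmx_mul map_mxM cD defA invmx_unitary // !mulmxA -[_ *m D *m D]mulmxA.
congr (_ *m _ *m _); apply/matrixP=> i j.
rewrite mul_diag_mx !mxE; case: eqP => [->|_]; rewrite ?mulr0n ?mulr0 // !mulr1n.
by rewrite -expr2 sqrtCK.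
Qed.

Lemma ent_inj (I : finType) (X Y : op C I) : (forall x y, ent X x y = ent Y x y) -> X = Y.
Proof.
move=> eXY; apply/matrixP=> i j.
by have := eXY (enum_val i) (enum_val j); rewrite /ent !enum_valK.
Qed.

Lemma ent_mkop (I : finType) (f : I -> I -> C) x y : ent (mkop f) x y = f x y.
Proof. by rewrite /ent mxE !enum_rankK. Qed.

Lemma trE (I : finType) (X : op C I) : \tr X = \sum_x ent X x x.
Proof.
rewrite /mxtrace (reindex (@enum_rank I)) //.
exact/onW_bij/enum_rank_bij.
Qed.

Lemma psd_ent_factor (I : finType) (X : op C I) : psd X ->
  {B : 'I_#|I| -> I -> C | forall x y, ent X x y = \sum_z (B z x)^* * B z y}.
Proof.
case/psd_factor=> B ->; exists (fun z x => B z (enum_rank x)) => x y.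
by rewrite /ent mxE; apply: eq_bigr => z _; rewrite !mxE.
Qed.

(** The form at [v] is a sum of squared moduli. The index type [T] is free, so that positivity of
    the operators built below can be shown by exhibiting any convenient Gram family. *)
Lemma psd_of_factor (I T : finType) (X : op C I) (B : T -> I -> C) :
  (forall x y, ent X x y = \sum_z (B z x)^* * B z y) -> psd X.
Proof.
move=> eX v.
pose w z := \sum_x B z x * v (enum_rank x) 0.
suff -> : (v ^t* *m X *m v) 0 0 = \sum_z (w z)^* * w z.
  by apply: sumr_ge0 => z _; rewrite mulrC mul_conjC_ge0.
transitivity (\sum_y \sum_x (v (enum_rank x) 0)^* * ent X x y * v (enum_rank y) 0).
  rewrite mxE (reindex (@enum_rank I)) /=; last exact/onW_bij/enum_rank_bij.
  apply: eq_bigr => y _; rewrite mxE mulr_suml.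
  rewrite (reindex (@enum_rank I)) /=; last exact/onW_bij/enum_rank_bij.
  by apply: eq_bigr => x _; rewrite !mxE.
transitivity (\sum_y \sum_x \sum_z (B z x * v (enum_rank x) 0)^* * (B z y * v (enum_rank y) 0)).
  apply: eq_bigr => y _; apply: eq_bigr => x _; rewrite eX mulr_sumr mulr_suml.
  by apply: eq_bigr => z _; rewrite rmorphM /=; ring.
rewrite exchange_big /=; under eq_bigr do rewrite exchange_big /=.
rewrite exchange_big /=; apply: eq_bigr => z _.
rewrite /w rmorph_sum /= mulr_suml; apply: eq_bigr => x _.
by rewrite mulr_sumr.
Qed.

Lemma ent_lin (I : finType) c (X Y : op C I) x y :
  ent (c *: X + Y) x y = c * ent X x y + ent Y x y.
Proof. by rewrite /ent !mxE. Qed.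

Lemma ent_ketbra (I : finType) (x y u v : I) :
  ent (ketbra C x y) u v = ((u == x) && (v == y))%:R.
Proof. by rewrite /ent mxE !(inj_eq enum_rank_inj). Qed.

Lemma ent_tens_op (K : finType) (I : K -> finType) (X : forall k, op C (I k)) p q :
  ent (tens_op X) p q = \prod_k ent (X k) (p k) (q k).
Proof. exact: ent_mkop. Qed.

Lemma ent_tens_map (K : finType) (I J : K -> finType)
    (E : forall k, op C (I k) -> op C (J k)) (X : op C (tens I)) a b :
  ent (tens_map E X) a b =
  \sum_(p : tens I) \sum_(q : tens I)
    ent X p q * \prod_k ent (E k (ketbra C (p k) (q k))) (a k) (b k).
Proof.
rewrite /tens_map /ent summxE; apply: eq_bigr => p _.
rewrite summxE; apply: eq_bigr => q _; rewrite mxE; congr (_ * _).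
exact: ent_tens_op.
Qed.

Lemma psd_pull (I J : finType) (g : J -> I) (X : op C I) : psd X -> psd (pull g X).
Proof.
case/psd_ent_factor=> B eX; apply: (@psd_of_factor _ _ _ (fun z x => B z (g x))).
by move=> x y; rewrite ent_mkop eX.
Qed.

Lemma tr_pull (I J : finType) (g : J -> I) (X : op C I) :
  bijective g -> \tr (pull g X) = \tr X.
Proof.
move=> g_bij; rewrite !trE (reindex g) /=; last exact: onW_bij.
by apply: eq_bigr => x _; rewrite ent_mkop.
Qed.

Lemma state_pull (I J : finType) (g : J -> I) (X : op C I) :
  bijective g -> is_state X -> is_state (pull g X).
Proof. by move=> g_bij [Xpsd trX]; split; [exact: psd_pull | rewrite tr_pull]. Qed.

Lemma state_tens_op (K : finType) (I : K -> finType) (X : forall k, op C (I k)) :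
  (forall k, is_state (X k)) -> is_state (tens_op X).
Proof.
move=> Xst; have [B eX] := all_sig (fun k => psd_ent_factor (proj1 (Xst k))).
split; last first.
  rewrite trE; under eq_bigr do rewrite ent_tens_op.
  rewrite (sum_tens_prod (fun k x => ent (X k) x x)) big1 // => k _.
  by rewrite -trE; case: (Xst k).
apply: (@psd_of_factor (tens I) (tens (fun k => 'I_#|I k|)) (tens_op X)
  (fun z p => \prod_k B k (z k) (p k))) => p q.
rewrite ent_tens_op; under eq_bigr do rewrite eX.
rewrite -sum_tens_prod; apply: eq_bigr => z _.
by rewrite rmorph_prod -big_split.
Qed.

(** Entrywise Kraus decomposition: the conjugate of [B z x a] is the (a, x) entry of the z-th Kraus
    operator. *)
Lemma cp_factor (I J : finType) (E : op C I -> op C J) : completely_positive E ->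
  {B : 'I_#|{: 'I_#|I| * J}| -> I -> J -> C | forall x y a b,
    ent (E (ketbra C x y)) a b = \sum_z (B z x a)^* * B z y b}.
Proof.
move=> Ecp.
(* E applied to half of an unnormalized maximally entangled state is its Choi matrix. *)
pose X : op C ('I_#|I| * I)%type :=
  mkop (fun u v => (enum_val u.1 == u.2)%:R * (enum_val v.1 == v.2)%:R).
have /Ecp/psd_ent_factor[B eB] : psd X.
  apply: (@psd_of_factor _ unit _ (fun _ u => (enum_val u.1 == u.2)%:R)) => u v.
  by rewrite ent_mkop big_const card_unit /= addr0 conjC_nat.
exists (fun z x a => B z (enum_rank x, a)) => x y a b.
rewrite -eB ent_mkop /=; congr (ent (E _) a b); apply: ent_inj => u v.
by rewrite ent_ketbra !ent_mkop /= !enum_rankK -natrM mulnb eq_sym [y == v]eq_sym.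
Qed.

(** For the trace, trace preservation of each [E k] leaves only the diagonal terms [p = q]. For
    positivity, a Gram factor of [X] is combined with Kraus decompositions of the [E k]. *)
Lemma state_tens_map (K : finType) (I J : K -> finType)
    (E : forall k, op C (I k) -> op C (J k)) (X : op C (tens I)) :
  (forall k, is_channel (E k)) -> is_state X -> is_state (tens_map E X).
Proof.
move=> Ech [Xpsd trX]; split; last first.
  rewrite -trX !trE; under eq_bigr do rewrite ent_tens_map.
  rewrite exchange_big /=; apply: eq_bigr => p _.
  rewrite exchange_big /= (bigD1 p) //= [Y in _ + Y]big1 ?addr0 => [|q npq].
    rewrite -mulr_sumr (sum_tens_prod (fun k a => ent (E k (ketbra C (p k) (p k))) a a)).
    rewrite big1 ?mulr1 // => k _; rewrite -trE; case: (Ech k) => _ _ ->.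
    rewrite trE (bigD1 (p k)) //= ent_ketbra eqxx big1 ?addr0 // => x /negbTE nx.
    by rewrite ent_ketbra nx.
  rewrite -mulr_sumr (sum_tens_prod (fun k a => ent (E k (ketbra C (p k) (q k))) a a)).
  (* An off-diagonal term has a factor in which a traceless matrix unit is mapped, and that factor
     has trace 0. *)
  have [k nk] : exists k, p k != q k.
    apply/existsP; rewrite -negb_forall; apply: contra npq => /forallP e.
    by apply/eqP/ffunP => k; apply/esym/eqP.
  rewrite (bigD1 k) //= -trE; case: (Ech k) => _ _ ->.
  rewrite trE [\sum_x ent _ _ _]big1 ?mul0r ?mulr0 // => x _.
  by rewrite ent_ketbra; case: andP => // -[/eqP ex /eqP ey]; rewrite -ex ey eqxx in nk.
have [A eX] := psd_ent_factor Xpsd.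
have Ecp k : completely_positive (E k) by case: (Ech k).
have [B eE] := all_sig (fun k => cp_factor (Ecp k)).
pose W : finType := tens (fun k => 'I_#|{: 'I_#|I k| * J k}|).
(* The Gram family of the image: a Gram factor of [X] contracted with a choice [w] of one Kraus
   operator for each tensor factor. *)
pose G (z : 'I_#|tens I|) (w : W) (a : tens J) :=
  \sum_p A z p * \prod_k B k (w k) (p k) (a k).
apply: (@psd_of_factor (tens J) ('I_#|tens I| * W)%type (tens_map E X)
  (fun z a => G z.1 z.2 a)) => a b.
rewrite ent_tens_map -(pair_bigA _ (fun z w => (G z w a)^* * G z w b)) /=.
transitivity (\sum_p \sum_q \sum_z \sum_(w : W)
   (A z p * \prod_k B k (w k) (p k) (a k))^* * (A z q * \prod_k B k (w k) (q k) (b k))).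
  apply: eq_bigr => p _; apply: eq_bigr => q _.
  rewrite eX mulr_suml; apply: eq_bigr => z _.
  under eq_bigr do rewrite eE.
  rewrite -sum_tens_prod mulr_sumr; apply: eq_bigr => w _.
  by rewrite big_split /= rmorphM rmorph_prod; ring.
etransitivity; first by apply: eq_bigr => p _; exact: exchange_big.
rewrite /= exchange_big /=; apply: eq_bigr => z _.
etransitivity; first by apply: eq_bigr => p _; exact: exchange_big.
rewrite /= exchange_big /=; apply: eq_bigr => w _.
rewrite rmorph_sum mulr_suml; apply: eq_bigr => p _.
by rewrite mulr_sumr.
Qed.

Lemma tr_ketbra (I : finType) (x y : I) : \tr (ketbra C x y) = (x == y)%:R.
Proof.
rewrite trE (bigD1 x) //= ent_ketbra eqxx big1 ?addr0 // => u /negbTE nu.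
by rewrite ent_ketbra nu.
Qed.

(** Outside [U] the output of the channel is traced out, and trace preservation turns its factor
    into the trace of a matrix unit, a Kronecker delta. *)
Lemma reduced_tens_map (K : finType) (I J : K -> finType)
    (E : forall k, op C (I k) -> op C (J k)) (X : op C (tens I))
    (U : {set K}) (a b : tens J) :
  (forall k, trace_preserving (E k)) ->
  ent (reduced U (tens_map E X)) (restr U a) (restr U b) =
  \sum_(s : tens I) \sum_(t : tens I) ent X s t *
    \prod_k (if k \in U then ent (E k (ketbra C (s k) (t k))) (a k) (b k)
             else (s k == t k)%:R).
Proof.
move=> Etp; rewrite ent_mkop.
(* The partial trace condition on a pair of output labels, split into one condition per factor. *)
pose c k (x y : J k) := if k \in U then (x == a k) && (y == b k) else x == y.
transitivity (\sum_(p : tens J) \sum_(q : tens J)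
    (\prod_k (c k (p k) (q k))%:R) * ent (tens_map E X) p q).
  rewrite big_mkcond; apply: eq_bigr => p _.
  have cE q : (restr U p == restr U a) && ((restr U q == restr U b) &&
      [forall k, (k \notin U) ==> (p k == q k)]) = [forall k, c k (p k) (q k)].
    rewrite !restr_eq; apply/and3P/forallP =>
      [[/forall_inP pa /forall_inP qb /forall_inP pq] k | h].
      by rewrite /c; case: ifPn => kU; [rewrite pa ?qb | apply: pq].
    split; apply/forall_inP => k kU; have := h k; rewrite /c.
    - by rewrite kU => /andP[].
    - by rewrite kU => /andP[].
    - by rewrite (negbTE kU).
  under [RHS]eq_bigr => q _ do rewrite (prod_natb _ predT) -cE.
  case: (restr U p == restr U a) => /=; last by rewrite big1 // => q _; rewrite mul0r.
  rewrite big_mkcond; apply: eq_bigr => q _.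
  by case: ifP => _; rewrite ?mul1r ?mul0r.
under eq_bigr => p _ do under eq_bigr => q _ do rewrite ent_tens_map mulr_sumr.
under eq_bigr => p _ do rewrite exchange_big /=.
rewrite exchange_big /=; apply: eq_bigr => s _.
under eq_bigr => p _ do under eq_bigr => q _ do rewrite mulr_sumr.
under eq_bigr => p _ do rewrite exchange_big /=.
rewrite exchange_big /=; apply: eq_bigr => t _.
under eq_bigr => p _ do under eq_bigr => q _ do rewrite mulrCA -big_split /=.
under eq_bigr => p _ do rewrite -mulr_sumr.
rewrite -mulr_sumr; congr (_ * _).
rewrite (sum_tens_prod2 (fun k x y => (c k x y)%:R * ent (E k (ketbra C (s k) (t k))) x y)).
apply: eq_bigr => k _; rewrite /c; case: ifP => kU.
  rewrite (bigD1 (a k)) //= (bigD1 (b k)) //= !eqxx mul1r.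
  rewrite big1 ?addr0 => [|y /negbTE ->]; last by rewrite andbF mul0r.
  rewrite big1 ?addr0 // => x /negbTE ->.
  by rewrite big1 // => y _; rewrite mul0r.
rewrite -tr_ketbra -(Etp k) trE; apply: eq_bigr => x _.
rewrite (bigD1 x) //= eqxx mul1r big1 ?addr0 // => y.
by rewrite eq_sym => /negbTE ->; rewrite mul0r.
Qed.

(* When x |-> (g x, e x) is a bijection onto a product basis, this traces out the
   factor that e labels. *)
Definition marginal (I J T : finType) (g : I -> J) (e : I -> T) (X : op C I) : op C J :=
  mkop (fun x y => \sum_(w : I * I | (g w.1, g w.2) == (x, y))
    (e w.1 == e w.2)%:R * ent X w.1 w.2).

(** Injectivity confines the trace to diagonal entries of [X]. A Gram family for the marginal takes
    a value of [e] as an additional index, one for each block that is summed. *)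
Lemma state_marginal (I J T : finType) (g : I -> J) (e : I -> T) (X : op C I) :
  injective (fun x => (g x, e x)) -> is_state X -> is_state (marginal g e X).
Proof.
move=> ge_inj [Xpsd trX]; split; last first.
  rewrite -trX !trE; under eq_bigr => x _ do rewrite ent_mkop big_mkcond /=.
  rewrite exchange_big /= -(pair_bigA _ (fun u v => \sum_x (if (g u, g v) == (x, x)
     then (e u == e v)%:R * ent X u v else 0))) /=.
  apply: eq_bigr => u _; rewrite (bigD1 u) //= [Y in _ + Y]big1 => [|v nvu].
    rewrite addr0 (bigD1 (g u)) //= !eqxx mul1r big1 ?addr0 // => x nx.
    by rewrite xpair_eqE eq_sym (negbTE nx).
  rewrite big1 // => x _; rewrite xpair_eqE.
  case: andP => // -[/eqP gu /eqP gv]; case: eqP => [euv|_]; last by rewrite mul0r.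
  by case/eqP: nvu; apply: ge_inj; rewrite gu gv euv.
have [B eX] := psd_ent_factor Xpsd.
apply: (psd_of_factor (B := fun (z : 'I_#|I| * T) x =>
  \sum_(u | g u == x) (e u == z.2)%:R * B z.1 u)) => x y.
rewrite ent_mkop.
rewrite -(pair_bigA _ (fun z t => (\sum_(u | g u == x) (e u == t)%:R * B z u)^* *
   \sum_(u | g u == y) (e u == t)%:R * B z u)) /=.
transitivity (\sum_z \sum_t \sum_(u | g u == x) \sum_(v | g v == y)
   ((e u == t)%:R * B z u)^* * ((e v == t)%:R * B z v)); last first.
  apply: eq_bigr => z _; apply: eq_bigr => t _.
  by rewrite rmorph_sum mulr_suml; apply: eq_bigr => u _; rewrite mulr_sumr.
symmetry; etransitivity; first by apply: eq_bigr => z _; exact: exchange_big.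
rewrite /= exchange_big /=; etransitivity.
  apply: eq_bigr => u _; etransitivity; first by apply: eq_bigr => z _; exact: exchange_big.
  exact: exchange_big.
rewrite /= pair_big_dep /=; apply: eq_big => [w | w _]; first by rewrite xpair_eqE.
rewrite eX mulr_sumr; apply: eq_bigr => z _.
rewrite (bigD1 (e w.1)) //= eqxx mul1r big1 ?addr0 => [|t nt].
  by rewrite [e w.2 == _]eq_sym; ring.
by rewrite eq_sym (negbTE nt) mul0r conjC0 mul0r.
Qed.

(** * Marginals of a network state *)

Section NetworkState.
Variables (G : dag) (d : vnode G -> nat) (dL : lnode G -> vnode G -> nat).
Variables (rhoL : forall L, op C (lout dL L)).
Variables (E : forall A, op C (vin dL A) -> op C (vis d A)).
Arguments E : clear implicits.

Definition network_state : op C (tens (vis d)) :=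
  tens_map E (pull (@regroup G dL) (tens_op rhoL)).

(** The inverse of [regroup], one visible node at a time. *)
Definition gather (P : forall L, lout dL L) (A : vnode G) : vin dL A :=
  [ffun L : parents A => P (val L) (exist _ A (valP L))].

Lemma gatherK : cancel (fun P : tens (lout dL) => [ffun A => gather P A] : tens (vin dL))
  (@regroup G dL).
Proof.
move=> P; apply/ffunP => L; apply/ffunP => -[A e]; rewrite !ffunE /=.
by set e' := valP _; rewrite (bool_irrelevance e' e).
Qed.

Lemma regroupK : cancel (@regroup G dL)
  (fun P : tens (lout dL) => [ffun A => gather P A] : tens (vin dL)).
Proof.
move=> p; apply/ffunP => A; apply/ffunP => -[L e]; rewrite !ffunE /=.
by set e' := valP _; rewrite (bool_irrelevance e' e).
Qed.

Lemma network_state_state : (forall L, is_state (rhoL L)) ->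
  (forall A, is_channel (E A)) -> is_state network_state.
Proof.
move=> rhoL_st E_ch; apply/(state_tens_map E_ch)/state_pull/state_tens_op => //.
by exists (fun P : tens (lout dL) => [ffun A => gather P A] : tens (vin dL));
  [exact: regroupK | exact: gatherK].
Qed.

(* Labels of a ket and of a bra for the systems emitted by L. *)
Definition legs (L : lnode G) : finType := (lout dL L * lout dL L)%type.

(** The Kronecker deltas for the systems that [L] sends to nodes that are traced out. *)
Definition agree (U : {set vnode G}) (L : lnode G) (z : legs L) : bool :=
  [forall A : children L, (val A \notin U) ==> (z.1 A == z.2 A)].

Definition latent_weight (U : {set vnode G}) (L : lnode G) (z : legs L) : C :=
  (agree U z)%:R * ent (rhoL L) z.1 z.2.

Definition kernel (z : forall L, legs L) (A : vnode G) (a b : vis d A) : C :=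
  ent (E A (ketbra C (gather (fun L => (z L).1) A) (gather (fun L => (z L).2) A))) a b.

(** Input labels of the channels are relabelled as output labels of the latent states, and the
    deltas left by the traced-out nodes are collected by latent node. Every factor is then local to
    one node. *)
Lemma reduced_network_state (U : {set vnode G}) (a b : tens (vis d)) :
  (forall A, trace_preserving (E A)) ->
  ent (reduced U network_state) (restr U a) (restr U b) =
  \sum_(z : tens legs)
    (\prod_L latent_weight U (z L)) * \prod_(A in U) kernel z (a A) (b A).
Proof.
move=> Etp; rewrite reduced_tens_map //.
pose toV (P : tens (lout dL)) : tens (vin dL) := [ffun A => gather P A].
have toV_bij : bijective toV.
  by exists (@regroup G dL); [exact: gatherK | exact: regroupK].
have reindV (F : tens (vin dL) -> C) : \sum_s F s = \sum_P F (toV P).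
  by rewrite (reindex toV) //; apply: onW_bij.
rewrite reindV; under eq_bigr => P _ do rewrite reindV.
rewrite sum_tens_pairs; apply: eq_bigr => z _.
set P : tens (lout dL) := [ffun k => (z k).1].
set Q : tens (lout dL) := [ffun k => (z k).2].
have rK R : regroup (toV R) = R := gatherK R.
have -> : \prod_L latent_weight U (z L) =
    (\prod_L ent (rhoL L) (P L) (Q L)) * \prod_L (agree U (z L))%:R.
  by rewrite -big_split; apply: eq_bigr => L _; rewrite /latent_weight mulrC !ffunE.
rewrite ent_mkop !rK ent_tens_op -mulrA; congr (_ * _).
rewrite (bigID (mem U)) /= mulrC; congr (_ * _).
  (* Grouped by visible or by latent node, the deltas say the same: ket and bra agree on each edge
     that ends outside [U]. *)
  rewrite (eq_bigr (fun A => (toV P A == toV Q A)%:R)); last by move=> A /negbTE ->.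
  rewrite (prod_natb _ predT) prod_natb; congr (nat_of_bool _)%:R.
  apply/forall_inP/forallP => [h L | h A AU].
    apply/forallP => -[A e]; apply/implyP => /h /eqP/ffunP/(_ (exist _ L e)).
    by rewrite !ffunE /=; set e' := valP _; rewrite (bool_irrelevance e' e) => ->.
  apply/eqP/ffunP => -[L e]; have /forallP/(_ (exist _ A e))/implyP/(_ AU)/eqP := h L.
  by rewrite !ffunE /=; set e' := valP _; rewrite (bool_irrelevance e' e) => ->.
apply: eq_bigr => A AU; rewrite AU /kernel.
congr (ent (E A (ketbra C _ _)) _ _); rewrite ffunE.
  by apply/ffunP => L; rewrite !ffunE.
by apply/ffunP => L; rewrite !ffunE.
Qed.

Definition local_weight (S : {set lnode G}) (U : {set vnode G}) (a b : tens (vis d))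
    (z : tens legs) : C :=
  (\prod_(L in S) latent_weight U (z L)) * \prod_(A in U) kernel z (a A) (b A).

Lemma eq_kernel (z1 z2 : forall L, legs L) (A : vnode G) (a b : vis d A) :
  (forall L, edge (inr L) (inl A) -> z1 L = z2 L) -> kernel z1 a b = kernel z2 a b.
Proof.
move=> ez; congr (ent (E A (ketbra C _ _)) _ _).
  by apply/ffunP => L; rewrite !ffunE ez //; exact: (valP L).
by apply/ffunP => L; rewrite !ffunE ez //; exact: (valP L).
Qed.

(** All systems of [L] are traced out, so ket and bra agree entirely and the sum is the trace of
    [rhoL L]. *)
Lemma sum_latent_weight (U : {set vnode G}) (L : lnode G) : is_state (rhoL L) ->
  (forall A, edge (inr L) (inl A) -> A \notin U) ->
  \sum_(z : legs L) latent_weight U z = 1.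
Proof.
move=> [_ <-] LU; rewrite trE.
rewrite -(pair_bigA _ (fun x y => latent_weight U ((x, y) : legs L))) /=.
apply: eq_bigr => x _; rewrite (bigD1 x) //= big1 ?addr0 => [|y nxy].
  rewrite /latent_weight /agree; case: forallP => [_|[]] /=; rewrite ?mul1r // => A.
  by rewrite eqxx implybT.
rewrite /latent_weight /agree; case: forallP => [/= h|_]; last by rewrite mul0r.
case/eqP: nxy; apply/ffunP => A; apply/esym/eqP.
by have := h A; rewrite LU //; exact: (valP A).
Qed.

(** [S] contains every parent of [U], so the kernels ignore the latent nodes outside [S]; each of
    these contributes a trace, which is 1. *)
Lemma reduced_network_state_local (S : {set lnode G}) (U : {set vnode G})
    (a b : tens (vis d)) (z0 : tens legs) :
  (forall L, is_state (rhoL L)) -> (forall A, trace_preserving (E A)) ->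
  (forall L A, edge (inr L) (inl A) -> A \in U -> L \in S) ->
  ent (reduced U network_state) (restr U a) (restr U b) =
  \sum_(z : stens legs S) local_weight S U a b (extend z0 z).
Proof.
move=> rhoL_st Etp US; rewrite reduced_network_state //.
pose F (j : bool) z := if j then local_weight S U a b z
  else \prod_(L in ~: S) latent_weight U (z L).
transitivity (\sum_(z : tens legs) \prod_j F j z).
  apply: eq_bigr => z _; rewrite big_bool /= (bigID (mem S)) /= mulrAC.
  by congr (_ * _); apply: eq_bigl => L; rewrite inE.
rewrite (sum_tens_classes (c := fun L => L \in S) z0); last first.
  move=> j z1 z2 ez; case: j ez => /= ez.
    congr (_ * _); first by apply: eq_bigr => L LS; rewrite ez.
    by apply: eq_bigr => A AU; apply: eq_kernel => L /US/(_ AU); apply: ez.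
  by apply: eq_bigr => L; rewrite inE => /negbTE LS; rewrite ez.
rewrite big_bool /=.
have -> : [set L | (L \in S) == true] = S by apply/setP => L; rewrite inE eqb_id.
have -> : [set L | (L \in S) == false] = ~: S by apply/setP => L; rewrite !inE eqbF_neg.
rewrite (sum_stens_prod (~: S) z0 (fun L z => latent_weight U (z : legs L)))
  [Y in _ * Y]big1 ?mulr1 //.
move=> L; rewrite inE => LS; apply: sum_latent_weight => // A eLA.
by apply: contra LS; apply: US eLA.
Qed.

End NetworkState.

(** * The inflated state *)

Section Inflated.
Variables (G' G : dag) (pi : copymap G' G) (d : vnode G -> nat).
Variables (dL : lnode G -> vnode G -> nat).
Variables (rhoL : forall L, op C (lout dL L)).
Variables (E : forall A, op C (vin dL A) -> op C (vis d A)).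
Arguments E : clear implicits.
(** Default labels, used to complete partial ones. *)
Variable z0 : tens (legs dL).

Notation dropL := (dropL pi).
Notation dropV := (dropV pi).

(** Dropping copy indices maps the parents of each visible node bijectively onto the parents of its
    image. *)
Hypothesis edge_drop : forall L A,
  edge (inr L) (inl A) -> edge (inr (dropL L)) (inl (dropV A)).
Hypothesis parent_inj : forall L1 L2 A, edge (inr L1) (inl A) ->
  edge (inr L2) (inl A) -> dropL L1 = dropL L2 -> L1 = L2.
Hypothesis parent_surj : forall L A, edge (inr L) (inl (dropV A)) ->
  exists2 L', edge (inr L') (inl A) & dropL L' = L.
Hypothesis pi_nonfanout : nonfanout pi.

Definition copydimL (L : lnode G') (A : vnode G') : nat := dL (dropL L) (dropV A).

Definition drop_child (L : lnode G') (A : children L) : children (dropL L) :=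
  exist _ (dropV (val A)) (edge_drop (valP A)).

Definition drop_parent (A : vnode G') (L : parents A) : parents (dropV A) :=
  exist _ (dropL (val L)) (edge_drop (valP L)).

Definition copy_out (L : lnode G') (P : lout dL (dropL L)) : lout copydimL L :=
  [ffun A : children L => P (drop_child A)].

Definition copy_in (A : vnode G') (p : vin dL (dropV A)) : vin copydimL A :=
  [ffun L : parents A => p (drop_parent L)].

(** The systems of the original latent state that no child of this copy receives; [copy_rhoL] traces
    them out. *)
Definition uncopied (L : lnode G') : {set children (dropL L)} :=
  [set A | [forall A' : children L, drop_child A' != A]].

Definition copy_rhoL (L : lnode G') : op C (lout copydimL L) :=
  marginal (@copy_out L) (restr (uncopied L)) (rhoL (dropL L)).

Definition copy_channel (A : vnode G') (X : op C (vin copydimL A)) :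
    op C (vis (copydim pi d) A) :=
  E (dropV A) (pull (@copy_in A) X).

(** Copied and uncopied systems together exhaust the systems of the original, which gives the
    injectivity that [state_marginal] asks for. *)
Lemma copy_rhoL_state L : is_state (rhoL (dropL L)) -> is_state (copy_rhoL L).
Proof.
apply: state_marginal => P Q [eg /eqP]; rewrite restr_eq => /forall_inP er.
apply/ffunP => A; case: (boolP (A \in uncopied L)) => [/er/eqP //|].
rewrite inE negb_forall => /existsP[A']; rewrite negbK => /eqP <-.
by have /ffunP/(_ A') := eg; rewrite !ffunE.
Qed.

Lemma drop_parent_inj A : injective (@drop_parent A).
Proof.
move=> L1 L2 /(congr1 val) /= e; apply/val_inj/(parent_inj (valP L1) (valP L2) e).
Qed.

Lemma copy_in_bij A : bijective (@copy_in A).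
Proof.
pose p0 := gather (fun L => (z0 L).1) (dropV A).
pose un q := sval (tens_along p0 q (@drop_parent_inj A)).
have unK : cancel un (@copy_in A).
  by move=> q; apply/ffunP => L; rewrite ffunE (svalP (tens_along p0 q _) L).
have inj : injective (@copy_in A).
  move=> p q /ffunP e; apply/ffunP => -[L eL].
  have [L' eL' dL'] := parent_surj eL.
  have := e (exist _ L' eL'); rewrite !ffunE /drop_parent /=.
  by case: L / dL' eL => eL; set e' := edge_drop _; rewrite (bool_irrelevance e' eL).
by exists un => // p; apply: inj; rewrite unK.
Qed.

(** [copy_channel] is the original channel after a unitary relabelling of its input, and ampliation
    commutes with that relabelling. *)
Lemma copy_channel_channel A : is_channel (E (dropV A)) -> is_channel (@copy_channel A).
Proof.
case=> Elin Ecp Etp; split.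
- move=> c X Y; rewrite /copy_channel -Elin; congr (E _ _).
  by apply/ent_inj => x y; rewrite !(ent_lin, ent_mkop).
- move=> n X /(psd_pull (fun u => (u.1, copy_in u.2))) /Ecp.
  congr psd; apply/ent_inj => x y; rewrite !ent_mkop; congr (ent (E _ _) _ _).
  by apply/ent_inj => i j; rewrite !ent_mkop.
- by move=> X; rewrite Etp tr_pull //; apply: copy_in_bij.
Qed.

Definition copy_state : op C (tens (vis (copydim pi d))) :=
  network_state copy_rhoL copy_channel.

Lemma copy_state_compatible : (forall L, is_state (rhoL L)) ->
  (forall A, is_channel (E A)) -> state_compatible copy_state.
Proof.
move=> rhoL_st E_ch; split.
  apply: network_state_state => [L | A]; first exact: copy_rhoL_state.
  exact: copy_channel_channel.
exists copydimL, copy_rhoL, copy_channel; split => // [L | A].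
  exact: copy_rhoL_state.
exact: copy_channel_channel.
Qed.

(** * Marginals of the inflated state *)

Definition copy_legs (L : lnode G') (z : legs dL (dropL L)) : legs copydimL L :=
  (copy_out z.1, copy_out z.2).

(** Counterpart of [agree] on labels of the original systems: agreement is required on every system
    that no child of [L] in [U] receives, be it uncopied or sent outside [U]. *)
Definition copy_agree (U : {set vnode G'}) (L : lnode G') (z : legs dL (dropL L)) : bool :=
  [forall A : children (dropL L),
    [forall A' : children L, (val A' \in U) ==> (drop_child A' != A)] ==>
    (z.1 A == z.2 A)].

Definition copy_weight (U : {set vnode G'}) (L : lnode G') (z : legs dL (dropL L)) : C :=
  (copy_agree U z)%:R * ent (rhoL (dropL L)) z.1 z.2.

(* Without fanout, at most one child of L in G' reads the system destined to a
   given child of dropL L, so each system is either traced out or read in U. *)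
Lemma copy_agreeE U L (z : legs dL (dropL L)) :
  copy_agree U z = agree U (copy_legs z) &&
    (restr (uncopied L) z.1 == restr (uncopied L) z.2).
Proof.
rewrite restr_eq; apply/forallP/andP => [h | [/forallP h1 /forall_inP h2] A].
  split; apply/forallP => A; apply/implyP => AU.
    rewrite /= !ffunE; apply: (implyP (h _)); apply/forallP => B; apply/implyP => BU.
    apply: contra AU => /eqP/(congr1 val) /= e.
    by rewrite -(pi_nonfanout (valP B) (valP A) e).
  apply: (implyP (h A)); apply/forallP => B; apply/implyP => _.
  by move: AU; rewrite inE => /forallP.
apply/implyP => AU; case: (boolP (A \in uncopied L)) => [/h2 //|].
rewrite inE negb_forall => /existsP[B]; rewrite negbK => /eqP eB.
case: A / eB AU => AU; have := h1 B; rewrite !ffunE => /implyP; apply.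
by apply: contraL AU => BU; rewrite negb_forall; apply/existsP; exists B; rewrite BU eqxx.
Qed.

(** The weight of a latent copy is the pushforward of a weight on original labels, the form needed
    to sum over original labels instead. *)
Lemma latent_weight_copy U L (w : legs copydimL L) :
  latent_weight copy_rhoL U w = \sum_(z | copy_legs z == w) copy_weight U z.
Proof.
rewrite /latent_weight ent_mkop mulr_sumr -surjective_pairing.
apply: eq_bigr => z /eqP <-; rewrite mulrA -natrM mulnb.
by rewrite /copy_weight copy_agreeE.
Qed.

(** For each latent copy, labels of all systems of its original, including those the copy does not
    emit. *)
Definition tens_legs : finType := tens (fun L => legs dL (dropL L)).

Lemma reduced_copy_state (U : {set vnode G'}) (a b : tens (vis (copydim pi d))) :
  (forall A, is_channel (E A)) ->
  ent (reduced U copy_state) (restr U a) (restr U b) =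
  \sum_(z : tens_legs) (\prod_L copy_weight U (z L)) *
    \prod_(A in U) kernel copy_channel (fun L => copy_legs (z L)) (a A) (b A).
Proof.
move=> E_ch; rewrite reduced_network_state; last first.
  by move=> A; case: (copy_channel_channel (E_ch (dropV A))).
under eq_bigr => w _ do under eq_bigr => L _ do rewrite latent_weight_copy.
rewrite (sum_tens_fibers copy_legs (fun L z => copy_weight U z)
  (fun w => \prod_(A in U) kernel copy_channel w (a A) (b A))).
apply: eq_bigr => z _; congr (_ * _); apply: eq_bigr => A _.
by apply: eq_kernel => L _; rewrite ffunE.
Qed.

Definition copy_local_weight (S : {set lnode G'}) (U : {set vnode G'})
    (a b : tens (vis (copydim pi d))) (z : tens_legs) : C :=
  (\prod_(L in S) copy_weight U (z L)) *
  \prod_(A in U) kernel copy_channel (fun L => copy_legs (z L)) (a A) (b A).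

(** When edges from [dropL L] to images of nodes in [U] lift to edges from [L], a system is received
    in [U] exactly if its destination lies in the image of [U]. *)
Lemma copy_agree_image (S : {set lnode G'}) (U : {set vnode G'}) L (z : legs dL (dropL L)) :
  (forall A, A \in U -> edge (inr (dropL L)) (inl (dropV A)) -> edge (inr L) (inl A)) ->
  copy_agree U z = agree (dropV @: U) z.
Proof.
move=> UL; apply: eq_forallb => A; congr (_ ==> _); apply/forallP/idP => [h | AU B].
  apply/imsetP => -[B BU eA]; have eB : edge (inr L) (inl B).
    by apply: UL => //; rewrite -eA; apply: (valP A).
  have := h (exist _ B eB); rewrite BU /= => /eqP; apply; apply/val_inj.
  exact: esym.
by apply/implyP => BU; apply: contra AU => /eqP <-; apply: imset_f.
Qed.

Lemma pull_ketbra (I J : finType) (g : I -> J) (x y : I) : injective g ->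
  pull g (ketbra C (g x) (g y)) = ketbra C x y.
Proof. by move=> gI; apply: ent_inj => u v; rewrite ent_mkop !ent_ketbra !(inj_eq gI). Qed.

(** Gathering copied labels is [copy_in] of the gathered original labels, and pulling a matrix unit
    back along the injective [copy_in] undoes this. *)
Lemma kernel_copy (A : vnode G') (z' : tens_legs) (z : tens (legs dL))
    (x y : vis d (dropV A)) :
  (forall L, edge (inr L) (inl A) -> z' L = z (dropL L)) ->
  kernel copy_channel (fun L => copy_legs (z' L)) (x : vis (copydim pi d) A) y =
  kernel E z x y.
Proof.
move=> ez; rewrite /kernel /copy_channel.
(* The projection [f] is left open so as to serve kets and bras alike. *)
have eg (f : forall L, legs dL L -> lout dL L) :
    gather (fun L => copy_out (f _ (z' L))) A = copy_in (gather (fun L => f _ (z L)) (dropV A)).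
  apply/ffunP => L; rewrite !ffunE /= ez; last exact: (valP L).

  rewrite /drop_child /=; set e1 := edge_drop _; set e2 := valP (drop_parent L).
  by rewrite (bool_irrelevance e1 e2).
rewrite (eg (fun L => fst)) (eg (fun L => snd)) pull_ketbra //.
exact: bij_inj (copy_in_bij A).
Qed.

Lemma copy_local_weightE (S : {set lnode G'}) (U : {set vnode G'})
    (a' b' : tens (vis (copydim pi d))) (a b : tens (vis d))
    (z' : tens_legs) (z : tens (legs dL)) :
  {in S &, injective dropL} -> {in U &, injective dropV} ->
  (forall L A, edge (inr L) (inl A) -> A \in U -> L \in S) ->
  (forall L A, L \in S -> A \in U ->
    edge (inr (dropL L)) (inl (dropV A)) -> edge (inr L) (inl A)) ->
  {in U, forall A, a (dropV A) = a' A} -> {in U, forall A, b (dropV A) = b' A} ->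
  {in S, forall L, z' L = z (dropL L)} ->
  copy_local_weight S U a' b' z' = local_weight rhoL E (dropL @: S) (dropV @: U) a b z.
Proof.
move=> SI UI US SU ea eb ez; rewrite /local_weight !big_imset //=; congr (_ * _).
  apply: eq_bigr => L LS; rewrite /copy_weight ez //.
  by rewrite (copy_agree_image S) // => A; apply: SU.
apply: eq_bigr => A AU; rewrite -ea // -eb //; apply: kernel_copy => L eL.
by apply: ez; apply: US eL AU.
Qed.

(** Every original system must agree, as if all of them were traced out in [G]; hence the comparison
    with [set0]. *)
Lemma sum_copy_weight (U : {set vnode G'}) (L : lnode G') : is_state (rhoL (dropL L)) ->
  (forall A, edge (inr L) (inl A) -> A \notin U) ->
  \sum_(z : legs dL (dropL L)) copy_weight U z = 1.
Proof.
move=> rhoL_st LU; rewrite -[RHS](sum_latent_weight (U := set0) rhoL_st); last first.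
  by move=> A _; rewrite inE.
apply: eq_bigr => z _; congr (_%:R * _); congr nat_of_bool.
apply: eq_forallb => A; rewrite inE /=.
by case: forallP => // -[] B; rewrite (negbTE (LU _ (valP B))).
Qed.

(** Latent nodes are coloured by the set [S j] that contains them, with one more colour for those in
    none. The sum factorizes over colours, and the extra colour contributes traces equal to 1. *)
Lemma reduced_copy_state_components (n : nat) (U : 'I_n -> {set vnode G'})
    (S : 'I_n -> {set lnode G'}) (a b : tens (vis (copydim pi d))) (z' : tens_legs) :
  (forall L, is_state (rhoL L)) -> (forall A, is_channel (E A)) ->
  (forall i j, i != j -> [disjoint U i & U j]) ->
  (forall i j, i != j -> [disjoint S i & S j]) ->
  (forall j L A, edge (inr L) (inl A) -> A \in U j -> L \in S j) ->
  ent (reduced (\bigcup_j U j) copy_state) (restr _ a) (restr _ b) =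
  \prod_j \sum_(z : stens (fun L => legs dL (dropL L)) (S j))
    copy_local_weight (S j) (U j) a b (extend z' z).
Proof.
move=> rhoL_st E_ch Udisj Sdisj US; rewrite reduced_copy_state //.
set UU := \bigcup_j U j.
have prod_unit (f : unit -> C) : \prod_u f u = f tt by rewrite (big_pred1 tt) // => -[].
pose c (L : lnode G') : 'I_n + unit := if [pick j | L \in S j] is Some j then inl j else inr tt.
have cE j L : (c L == inl j) = (L \in S j).
  rewrite /c; case: pickP => [i Li | /(_ j) -> //].
  apply/eqP/idP => [[<-] //| Lj]; congr inl; apply/eqP; apply: contraLR Lj => /Sdisj.
  by move=> /disjointFr ->.
pose F (j : 'I_n + unit) (z : tens_legs) := match j with
  | inl j => copy_local_weight (S j) (U j) a b z
  | inr _ => \prod_(L in [set L | c L == inr tt]) copy_weight UU (z L) end.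
(* A child of [L] in [U i] puts [L] into [S i], so by disjointness [L] in [S j] only has children in
   the union that lie in [U j]. *)
have wE j L (z : legs dL (dropL L)) : L \in S j -> copy_weight UU z = copy_weight (U j) z.
  move=> LS; congr (_%:R * _); congr nat_of_bool.
  apply: eq_forallb => A; congr (_ ==> _); apply: eq_forallb => B; congr (_ ==> _).
  apply/bigcupP/idP => [[i _ Bi] | Bj]; last by exists j.
  suff -> : j = i by [].
  apply/eqP; apply: contraLR Bi => /Sdisj/disjointFr/(_ LS) Li.
  by apply: contraFN Li; apply: US (valP B).
transitivity (\sum_(z : tens_legs) \prod_j F j z).
  apply: eq_bigr => z _; rewrite big_sumType /= prod_unit.
  rewrite /copy_local_weight [in RHS]big_split /= [RHS]mulrAC.
  rewrite partition_disjoint_bigcup //; congr (_ * _).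
  rewrite (partition_big c predT) //= big_sumType /= prod_unit.
  congr (_ * _); last by apply: eq_bigl => L; rewrite inE.
  apply: eq_bigr => j _; apply: eq_big => L; first by rewrite cE.
  by rewrite cE => /wE.
rewrite (sum_tens_classes (c := c) z'); last first.
  case=> [j | []] z1 z2 ez /=.
    congr (_ * _); first by apply: eq_bigr => L LS; rewrite ez //; apply/eqP; rewrite cE.
    apply: eq_bigr => A AU; apply: eq_kernel => L eL.
    by rewrite ez //; apply/eqP; rewrite cE; apply: US eL AU.
  by apply: eq_bigr => L; rewrite inE => /eqP cL; rewrite ez.
rewrite big_sumType /= prod_unit.
rewrite (sum_stens_prod _ z' (fun L z => copy_weight UU z)) [Y in _ * Y]big1 ?mulr1 => [|L].
  apply: eq_bigr => j _; have -> // : [set L | c L == inl j] = S j.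
  by apply/setP => L; rewrite inE cE.
rewrite inE => cL; apply: sum_copy_weight => // A eL; apply/bigcupP => -[j _ /(US _ _ _ eL)].
by rewrite -cE (eqP cL).
Qed.

Lemma reduced_copy_state_prod (n : nat) (U : 'I_n -> {set vnode G'})
    (S : 'I_n -> {set lnode G'}) (a' b' : tens (vis (copydim pi d)))
    (a b : 'I_n -> tens (vis d)) :
  (forall L, is_state (rhoL L)) -> (forall A, is_channel (E A)) ->
  (forall i j, i != j -> [disjoint U i & U j]) ->
  (forall i j, i != j -> [disjoint S i & S j]) ->
  (forall j, {in S j &, injective dropL}) -> (forall j, {in U j &, injective dropV}) ->
  (forall j L A, edge (inr L) (inl A) -> A \in U j -> L \in S j) ->
  (forall j L A, L \in S j -> A \in U j ->
    edge (inr (dropL L)) (inl (dropV A)) -> edge (inr L) (inl A)) ->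
  (forall j, {in U j, forall A, a j (dropV A) = a' A}) ->
  (forall j, {in U j, forall A, b j (dropV A) = b' A}) ->
  ent (reduced (\bigcup_j U j) copy_state) (restr _ a') (restr _ b') =
  \prod_j ent (reduced (dropV @: U j) (network_state rhoL E)) (restr _ (a j)) (restr _ (b j)).
Proof.
move=> rhoL_st E_ch Udisj Sdisj SI UI US SU ea eb.
pose z' : tens_legs := [ffun L => z0 (dropL L)].
rewrite (reduced_copy_state_components _ _ z' rhoL_st E_ch Udisj Sdisj US).
apply: eq_bigr => j _.
(* The image of [S j] contains all parents of the image of [U j], since parents lift along the
   inflation. *)
rewrite (reduced_network_state_local (S := dropL @: S j) _ _ z0) //; first last.
- move=> L B eLB /imsetP[A AU eB]; rewrite eB in eLB.
  by have [L' eL' <-] := parent_surj eLB; apply: imset_f; apply: US eL' AU.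
- by move=> A; case: (E_ch A).
apply: sum_extend_along => [|p' p ep]; first exact: SI.
exact: (copy_local_weightE (SI j) (UI j) (US j) (SU j) (ea j) (eb j) ep).
Qed.

End Inflated.

(** Over an empty basis the trace would be 0 and not 1. *)
Lemma state_point (I : finType) (X : op C I) : is_state X -> I.
Proof.
case=> _; rewrite trE; case: (pickP (@predT I)) => [x //|none].
by rewrite big_pred0 // => /eqP; rewrite eq_sym oner_eq0.
Qed.

Lemma ent_push (I J : finType) (g : I -> J) (X : op C I) (x y : I) : injective g ->
  ent (push g X) (g x) (g y) = ent X x y.
Proof.
move=> g_inj; rewrite ent_mkop (big_pred1 x) => [|u]; last by rewrite inj_eq.
by rewrite (big_pred1 y) // => v; rewrite inj_eq.
Qed.

End Operators.

(** * Injectable and expressible sets *)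

Section InflationGraph.
Variables (G' G : dag) (pi : copymap G' G).

Lemma ancestral_self (U : {set node G'}) x : x \in U -> x \in ancestral U.
Proof. by move=> xU; rewrite inE; apply/existsP; exists x; rewrite xU connect0. Qed.

Lemma ancestral_parent (H : dag) (U : {set node H}) x y :
  y \in U -> edge x y -> x \in ancestral U.
Proof. by move=> yU e; rewrite inE; apply/existsP; exists y; rewrite yU connect1. Qed.

Lemma ansim_edge (U' : {set node G'}) (U : {set node G}) x y : ansim pi U' U ->
  x \in ancestral U' -> y \in ancestral U' ->
  edge x y = edge (dropnode pi x) (dropnode pi y).
Proof. by case/and5P=> _ _ _ _ /forall_inP h xU yU; apply/eqP/(forall_inP (h x xU)). Qed.

Lemma inflation_edge L A : inflation pi ->
  edge (inr L) (inl A) -> edge (inr (dropL pi L)) (inl (dropV pi A)).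
Proof.
move=> infl e; have /= <- // := ansim_edge (x := inr L) (y := inl A) (infl (inl A)).
  by apply: ancestral_parent e; rewrite inE.
by apply: ancestral_self; rewrite inE.
Qed.

Lemma inflation_parent_inj L1 L2 A : inflation pi -> edge (inr L1) (inl A) ->
  edge (inr L2) (inl A) -> dropL pi L1 = dropL pi L2 -> L1 = L2.
Proof.
move=> infl e1 e2 eL; have /and5P[_ _ /dinjectiveP inj _ _] := infl (inl A).
apply: (@inr_inj (vnode G')); apply: inj; last by rewrite /= eL.
  by apply: ancestral_parent e1; rewrite inE.
by apply: ancestral_parent e2; rewrite inE.
Qed.

(** A parent of the image lies in its ancestral subgraph, hence lifts to the ancestral subgraph of
    [A], where edges are reflected. *)
Lemma inflation_parent_surj L A : inflation pi -> edge (inr L) (inl (dropV pi A)) ->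
  exists2 L', edge (inr L') (inl A) & dropL pi L' = L.
Proof.
move=> infl e; have sim := infl (inl A); have /and5P[_ _ _ /eqP anc _] := sim.
have : inr L \in ancestral [set dropnode pi (inl A)].
  by apply: ancestral_parent e; rewrite inE.
rewrite -anc => /imsetP[[//|L'] L'anc /= [eL]]; exists L' => //.
rewrite (ansim_edge sim) /= -?eL //.
by apply: ancestral_self; rewrite inE.
Qed.

Definition latent_ancestors (U : {set vnode G'}) : {set lnode G'} :=
  [set L | inr L \in ancestral (vset U)].

Lemma vset_ancestral (U : {set vnode G'}) A : A \in U -> inl A \in ancestral (vset U).
Proof. by move=> AU; apply/ancestral_self/imset_f. Qed.

Lemma latent_ancestors_parent (U : {set vnode G'}) L A :
  edge (inr L) (inl A) -> A \in U -> L \in latent_ancestors U.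
Proof. by move=> e AU; rewrite in_set; apply: ancestral_parent e; apply: imset_f. Qed.

Lemma injectable_dropV_inj (U : {set vnode G'}) :
  injectable pi U -> {in U &, injective (dropV pi)}.
Proof.
case/existsP=> V /and5P[/dinjectiveP inj _ _ _ _] A B AU BU e.
apply: (@inl_inj _ (lnode G')); apply: inj; [exact: imset_f | exact: imset_f |].
by rewrite /= e.
Qed.

Lemma injectable_dropL_inj (U : {set vnode G'}) :
  injectable pi U -> {in latent_ancestors U &, injective (dropL pi)}.
Proof.
case/existsP=> V /and5P[_ _ /dinjectiveP inj _ _] A B.
rewrite in_set => AU; rewrite in_set => BU e.
by apply: (@inr_inj (vnode G')); apply: inj => //=; rewrite e.
Qed.

Lemma injectable_edge (U : {set vnode G'}) L A : injectable pi U ->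
  L \in latent_ancestors U -> A \in U ->
  edge (inr (dropL pi L)) (inl (dropV pi A)) -> edge (inr L) (inl A).
Proof.
case/existsP=> V sim; rewrite in_set => LU AU.
by rewrite (ansim_edge sim LU (vset_ancestral AU)).
Qed.

End InflationGraph.

(** * Identification of the marginals with the product states *)

Lemma copy_basis_inj (G' G : dag) (pi : copymap G' G) (d : vnode G -> nat)
  (U : {set vnode G'}) : injective (@copy_basis G' G pi d U).
Proof.
move=> u v /ffunP e; apply/ffunP => -[B BU].
case/imsetP: (BU) => A AU eB; case: B / {eB}(esym eB) BU => BU.
by have := e (exist _ A AU); rewrite !ffunE /= (bool_irrelevance (imset_f _ _) BU).
Qed.

Lemma reduced_copy_state_product (C : numClosedFieldType) (G' G : dag)
    (pi : copymap G' G) (d : vnode G -> nat) (dL : lnode G -> vnode G -> nat)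
    (rhoL : forall L, op C (lout dL L)) (E : forall A, op C (vin dL A) -> op C (vis d A))
    (z0 : tens (legs dL)) (a0 : tens (vis d))
    (rho : op_family C d (ImagesInjectableSets pi))
    (Y : {set vnode G'}) (D : decomposition pi Y) (infl : inflation pi) :
  nonfanout pi ->
  (forall L, is_state (rhoL L)) -> (forall A, is_channel (E A)) ->
  (forall U, reduced (val U) (network_state rhoL E) = rho U) ->
  reduced Y (copy_state rhoL E (fun L A => @inflation_edge G' G pi L A infl)) =
  product_state D rho.
Proof.
move=> nf rhoL_st E_ch rhoE; apply: ent_inj => x y.
pose a0' : tens (vis (copydim pi d)) := [ffun A => (a0 (dropV pi A) : vis (copydim pi d) A)].
rewrite -(restr_extend a0' x) -(restr_extend a0' y).
move: (extend a0' x) (extend a0' y) => {x y} a b.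
pose U (j : 'I_(ncomp D)) := component j.
have injU j : injectable pi (U j) := comp_injectable j.
have injD j : injective (fun A : {A | A \in U j} => dropV pi (val A)).
  by move=> A B /(injectable_dropV_inj (injU j)) e; apply/val_inj/e; apply: valP.
(* A label on [G] that carries the values of [p] on component [j], and [a0] on nodes outside its
   image. *)
pose lower (p : tens (vis (copydim pi d))) j : tens (vis d) :=
  sval (tens_along a0 (restr (U j) p) (@injD j)).
have lowerE p j : {in U j, forall A, lower p j (dropV pi A) = p A}.
  move=> A AU; have := svalP (tens_along a0 (restr (U j) p) (@injD j)) (exist _ A AU).
  by rewrite ffunE.
have splitE p j : split_basis D (restr Y p) j = copy_basis (restr _ (lower p j)).
  by apply/ffunP => -[A AU]; rewrite !ffunE /= lowerE.
rewrite [RHS]ent_mkop ent_tens_op.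
set psi := copy_state _ _ _.
(* The set is generalized to [Z] because the types of [D] and of the labels depend on [Y]. *)
suff key Z : Z = \bigcup_j U j -> ent (reduced Z psi) (restr Z a) (restr Z b) =
    \prod_j ent (reduced (dropV pi @: U j) (network_state rhoL E))
      (restr _ (lower a j)) (restr _ (lower b j)).
  rewrite (key _ (comp_cover D)); apply: eq_bigr => j _.
  rewrite !splitE ent_push -?rhoE //; exact: copy_basis_inj.
move=> ->.
have pinj L1 L2 A := @inflation_parent_inj G' G pi L1 L2 A infl.
have psurj L A := @inflation_parent_surj G' G pi L A infl.
apply: (reduced_copy_state_prod z0 _ pinj psurj nf
  (S := fun j => latent_ancestors (U j))) => //.
(* Every node is in its own ancestral subgraph, so disjoint ancestral subgraphs force disjoint
   components. *)
- move=> i j /(comp_disjoint (d := D)) dij; apply/pred0P => A /=.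
  apply/negP => /andP[/vset_ancestral Ai /vset_ancestral].
  by rewrite (disjointFr dij Ai).
- move=> i j /(comp_disjoint (d := D)) dij; apply/pred0P => L /=.
  by apply/negP => /andP[]; rewrite in_set => Li; rewrite in_set (disjointFr dij Li).
- by move=> j; apply: injectable_dropL_inj.
- by move=> j; apply: injectable_dropV_inj.
- by move=> j L A; apply: latent_ancestors_parent.
- by move=> j L A; apply: injectable_edge.
Qed.

Theorem corollary1 (R : realType) (G G' : dag) (d : vnode G -> nat)
  (pi : copymap G' G)
  (rho : op_family R[i] d (ImagesInjectableSets pi))
  (T' : {set {set vnode G'}})
  (hT' : forall Y, Y \in T' -> expressible pi Y)
  (dec : forall Y, expressible pi Y -> decomposition pi Y)
  (I : op_family R[i] (copydim pi d) T' -> Prop) :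
  is_network G -> inflation pi -> nonfanout pi ->
  compatible rho ->
  causal_compatibility_ineq I ->
  I (fun Y => product_state (dec (val Y) (hT' (val Y) (valP Y))) rho).
Proof.
move=> _ infl nf [r [r_st [dL [rhoL [E [rhoL_st E_ch rE]]]]] rhoE] I_ineq.
have a0 : tens (vis d) := state_point r_st.
(* The realization itself supplies default labels, as a basis that carries a state is inhabited. *)
pose z0 : tens (legs dL) :=
  [ffun L => (state_point (rhoL_st L), state_point (rhoL_st L))].
pose edge_drop L A := @inflation_edge G' G pi L A infl.
apply: I_ineq; exists (copy_state rhoL E edge_drop).
  apply: copy_state_compatible => // [L1 L2 A | L A].
    exact: inflation_parent_inj.
  exact: inflation_parent_surj.
move=> Y; apply: reduced_copy_state_product => // U.
by rewrite -rhoE rE.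
Qed.
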